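(* Let $K$ and $t$ be positive integers with $t<K$. Then the MN PDA, i.e. a $(t+1)$-$\left(K,\binom{K}{t},\binom{K-1}{t-1},\binom{K}{t+1}\right)$ PDA, is Pareto-optimal.
   Context: Write $[0,b)=\{0,1,\ldots,b-1\}$. For positive integers $K,F$, a $(K,F,S)$ placement delivery array (PDA) is an $F\times K$ array $\mathbf{P}=(p_{i,j})$, $i\in[0,F)$, $j\in[0,K)$, each of whose entries is either the symbol $*$ (''star'') or an integer from $[0,S)$, such that: whenever two distinct entries satisfy $p_{i_1,j_1}=p_{i_2,j_2}=s$ with $s$ an integer, then (a) $i_1\neq i_2$ and $j_1\neq j_2$, and (b) $p_{i_1,j_2}=p_{i_2,j_1}=*$. A $(K,F,Z,S)$ PDA (with $1\le Z\leq F$) is a $(K,F,S)$ PDA in which each column has exactly $Z$ stars. It is $g$-regular, written $g$-$(K,F,Z,S)$ PDA, if each integer of $[0,S)$ appears exactly $g$ times in the array. The rate of a $(K,F,Z,S)$ PDA is $R=S/F$, its packet number is $F$, and its memory ratio is $Z/F$. A $(K,F,Z,S)$ PDA is called Pareto-optimal if it achieves the tradeoff between $R$ and $F$ among PDAs with the same number of columns $K$ and the same memory ratio: for every $(K,F',Z',S')$ PDA with $Z'/F'=Z/F$, (i) if $F'<F$ then $S'/F'>S/F$, and (ii) if $S'/F'<S/F$ then $F'>F$. *)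

(* Defs.v *)
From HB Require Import structures.
From mathcomp Require Import all_boot all_order all_algebra.

Set Implicit Arguments.
Unset Strict Implicit.
Unset Printing Implicit Defensive.

Import Order.TTheory GRing.Theory Num.Theory.
Local Open Scope ring_scope.

(* [None] is the star, [Some s] the integer [s] of [0, S).  Distinctness of
   entries is distinctness of positions, not of values. *)
Definition pda_condition (K F S : nat) (P : 'M[option 'I_S]_(F, K)) : Prop :=
  forall (i1 i2 : 'I_F) (j1 j2 : 'I_K) (s : 'I_S),
    (i1, j1) <> (i2, j2) -> P i1 j1 = Some s -> P i2 j2 = Some s ->
    [/\ i1 <> i2, j1 <> j2, P i1 j2 = None & P i2 j1 = None].

Record pda (K F Z S : nat) : Type := Pda {
  pda_array :> 'M[option 'I_S]_(F, K);
  pda_K_gt0 : (0 < K)%N;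
  pda_Z_bounds : (1 <= Z <= F)%N;
  pda_conditionP : pda_condition pda_array;
  pda_column_stars :
    forall j : 'I_K, #|[set i : 'I_F | pda_array i j == None]| = Z
}.

Definition regular (g K F Z S : nat) (P : pda K F Z S) : Prop :=
  forall s : 'I_S, #|[set ij : 'I_F * 'I_K | P ij.1 ij.2 == Some s]| = g.

Definition rate (K F Z S : nat) (P : pda K F Z S) : rat := S%:R / F%:R.

Definition packet_number (K F Z S : nat) (P : pda K F Z S) : nat := F.

Definition memory_ratio (K F Z S : nat) (P : pda K F Z S) : rat :=
  Z%:R / F%:R.

Definition pareto_optimal (K F Z S : nat) (P : pda K F Z S) : Prop :=
  forall (F' Z' S' : nat) (P' : pda K F' Z' S'),
    memory_ratio P' = memory_ratio P ->
    ((packet_number P' < packet_number P)%N -> rate P < rate P') /\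
    (rate P' < rate P -> (packet_number P < packet_number P')%N).

(* Main.v *)
Require Import Defs.
From mathcomp Require Import all_boot all_order all_algebra.
From mathcomp Require Import ring.

(** Let row [i] have [a_i] stars.  An integer occurring in row [i] occurs at
    most [a_i + 1] times, because its other occurrences put stars of row [i]
    in pairwise distinct columns.  Giving weight [1 / (a_i + 1)] to every
    integer entry of row [i], each integer thus gets total weight at most [1],
    so [S >= \sum_i (K - a_i) / (a_i + 1)].  The [a_i] have average [t] when
    the memory ratio is [t / K], and convexity yields
    [S / F >= (K - t) / (t + 1)], the rate of the MN PDA.

    In case of equality every row has exactly [t] stars and every integer
    occurs [t + 1] times, so the columns of an integer [s] in row [i], column
    [j] are [j] together with the star columns of row [i].  Hence the set of
    star columns of rows is closed under exchanging one element, so it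
    contains all [t]-subsets of the columns, and [F >= 'C(K, t)]. *)

Set Implicit Arguments.
Unset Strict Implicit.
Unset Printing Implicit Defensive.

Import Order.TTheory GRing.Theory Num.Theory.
Local Open Scope ring_scope.

(** Induction on [#|f i :\: B|], starting from [i0]. Since [f i] and [B] have equal size, either
    they coincide or each has an element outside the other; swapping these two brings the set closer
    to [B]. *)
Lemma exchange_closed_draws (T : finType) (I : Type) (f : I -> {set T})
    (t : nat) (i0 : I) :
    (forall i, #|f i| = t) ->
    (forall i x y, x \notin f i -> y \in f i ->
       exists i', f i' = (x |: f i) :\ y) ->
  forall B : {set T}, #|B| = t -> exists i, f i = B.
Proof.
move=> card_f exchange B card_B.
have [n] := ubnP #|f i0 :\: B|; elim: n i0 => // n IHn i lt_n.
have [sub_iB | /subsetPn[y y_i yNB]] := boolP (f i \subset B).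
  by exists i; apply/eqP; rewrite eqEcard sub_iB card_f card_B /=.
have /subsetPn[x x_B xNi] : ~~ (B \subset f i).
  apply/negP=> sub_Bi; move: yNB.
  have /eqP -> : B == f i by rewrite eqEcard sub_Bi card_f card_B /=.
  by rewrite y_i.
have [i' f_i'] := exchange i x y xNi y_i.
apply: (IHn i'); rewrite f_i'; rewrite ltnS in lt_n; apply: leq_trans lt_n.
apply/proper_card/properP; split.
  apply/subsetP=> z; rewrite !inE => /and3P[zNB _ /predU1P[zx | ->]].
    by rewrite zx x_B in zNB.
  by rewrite zNB.
by exists y; rewrite !inE ?yNB ?y_i ?eqxx ?andbF.
Qed.

(* The right-hand side lies above its tangent line at [a = t]. *)
Lemma tangent_leif (K a t : nat) :
  (K.+1%:R * (t.+1%:R^-1 - (a%:R - t%:R) / t.+1%:R ^+ 2) - 1 : rat)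
    <= (K%:R - a%:R) / a.+1%:R ?= iff (a == t).
Proof.
have a_neq0 : (a.+1%:R : rat) != 0 by rewrite pnatr_eq0.
have t_neq0 : (t.+1%:R : rat) != 0 by rewrite pnatr_eq0.
have diff : (K%:R - a%:R) / a.+1%:R
    - (K.+1%:R * (t.+1%:R^-1 - (a%:R - t%:R) / t.+1%:R ^+ 2) - 1)
    = K.+1%:R * (a%:R - t%:R) ^+ 2 / (a.+1%:R * t.+1%:R ^+ 2) :> rat.
  move: a_neq0 t_neq0; rewrite -!(natr1 a) -!(natr1 t) -!(natr1 K).
  by move=> a_neq0 t_neq0; field; rewrite ?a_neq0 ?t_neq0.
split.
  rewrite -subr_ge0 diff.
  by apply: divr_ge0; apply: mulr_ge0; rewrite ?ler0n ?sqr_ge0.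
rewrite eq_sym -subr_eq0 diff !mulf_eq0 invr_eq0 mulf_eq0 !expf_eq0 /=.
by rewrite (negPf a_neq0) (negPf t_neq0) pnatr_eq0 subr_eq0 eqr_nat ?orbF orbb.
Qed.

Section StarCounting.

Variables (K F Z S : nat) (P : pda K F Z S).

Definition stars (i : 'I_F) : {set 'I_K} := [set j | P i j == None].

Definition occurrences (s : 'I_S) : {set 'I_F * 'I_K} :=
  [set ij | P ij.1 ij.2 == Some s].

Lemma sum_card_stars : (\sum_i #|stars i| = K * Z)%N.
Proof.
under eq_bigr => i _ do rewrite /stars -sum1dep_card.
rewrite (exchange_big_dep predT) //=.
rewrite -[K in RHS](card_ord K) -sum_nat_const; apply: eq_bigr => j _.
by rewrite sum1dep_card (pda_column_stars P).
Qed.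

Lemma snd_occurrences_inj (s : 'I_S) : {in occurrences s &, injective snd}.
Proof.
move=> [i1 j1] [i2 j2]; rewrite !inE /= => /eqP P1 /eqP P2 eq_j.
apply/eqP/idPn => /eqP neq.
by have [_ /(_ eq_j)] := pda_conditionP neq P1 P2.
Qed.

Lemma occurrences_columns (s : 'I_S) (i : 'I_F) (j : 'I_K) :
  (i, j) \in occurrences s -> snd @: occurrences s \subset j |: stars i.
Proof.
rewrite inE /= => /eqP Pij; apply/subsetP=> _ /imsetP[[i' j'] + ->].
rewrite !inE /= => /eqP Pij'.
have [//|neq_j] := eqVneq j' j; rewrite orFb.
have neq : (i, j) <> (i', j') by case=> _ eq_j; rewrite eq_j eqxx in neq_j.
by have [_ _ -> _] := pda_conditionP neq Pij Pij'.
Qed.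

Lemma card_stars1 (s : 'I_S) (i : 'I_F) (j : 'I_K) :
  (i, j) \in occurrences s -> #|j |: stars i| = #|stars i|.+1.
Proof. by rewrite cardsU1 !inE /= => /eqP ->. Qed.

Lemma card_occurrences_le (s : 'I_S) (ij : 'I_F * 'I_K) :
  ij \in occurrences s -> (#|occurrences s| <= #|stars ij.1|.+1)%N.
Proof.
case: ij => i j ij_s; rewrite -(card_in_imset (@snd_occurrences_inj s)).
by rewrite -(card_stars1 ij_s) subset_leq_card ?occurrences_columns.
Qed.

Lemma occurrences_weight_le1 (s : 'I_S) :
  \sum_(ij in occurrences s) (#|stars ij.1|.+1%:R : rat)^-1 <= 1.
Proof.
(* An integer that never occurs has weight 0. Otherwise each of its n occurrences weighs at most
   1/n. *)
have [-> | [ij0 ij0_s]] := set_0Vmem (occurrences s).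
  by rewrite big_set0.
have occ_gt0 : (0 < #|occurrences s|)%N by apply/card_gt0P; exists ij0.
have sum1 : \sum_(ij in occurrences s) (#|occurrences s|%:R : rat)^-1 = 1.
  by rewrite sumr_const -[LHS]mulr_natr mulVf // pnatr_eq0 -lt0n.
rewrite -[leRHS]sum1; apply: ler_sum => ij ij_s.
by rewrite lef_pV2 ?posrE ?ltr0n // ler_nat card_occurrences_le.
Qed.

(** Both sides are the total weight of the integer entries, grouped by integer on the left and by
    row on the right. *)
Lemma sum_occurrences_weight :
  \sum_s \sum_(ij in occurrences s) (#|stars ij.1|.+1%:R : rat)^-1
    = \sum_i (K%:R - #|stars i|%:R) / #|stars i|.+1%:R.
Proof.
transitivity (\sum_(ij : 'I_F * 'I_K | P ij.1 ij.2 != None)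
                (#|stars ij.1|.+1%:R : rat)^-1).
  rewrite (exchange_big_dep (fun ij : 'I_F * 'I_K => P ij.1 ij.2 != None)) /=.
    apply: eq_bigr => -[i j] /=; case Pij: (P i j) => [s|//] _.
    by rewrite (big_pred1 s) // => s'; rewrite inE /= Pij eq_sym.
  by move=> s ij _; rewrite inE => /eqP ->.
rewrite -(pair_big_dep xpredT (fun i j => P i j != None)
  (fun i _ => (#|stars i|.+1%:R : rat)^-1)) /=.
apply: eq_bigr => i _; rewrite sumr_const -[LHS]mulr_natl; congr (_ * _).
have card_i : (#|stars i| + #|[pred j | P i j != None]| = K)%N.
  rewrite -[RHS](card_ord K) -(cardC (stars i)); congr (_ + _)%N.
  by apply: eq_card => j; rewrite !inE.
by rewrite -[X in X%:R - _]card_i natrD addrAC subrr add0r.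
Qed.

Section Bound.

Variable t : nat.
(** The memory ratio is [t / K], with denominators cleared; by [sum_card_stars], rows then have [t]
    stars on average. *)
Hypothesis ratio : (K * Z = t * F)%N.

(** The linear terms cancel because the average of [#|stars i|] is [t], which leaves [F] times (K +
    1) / (t + 1) - 1. *)
Lemma sum_tangent :
  \sum_(i < F) (K.+1%:R * (t.+1%:R^-1 - (#|stars i|%:R - t%:R) / t.+1%:R ^+ 2)
                - 1 : rat)
    = F%:R * ((K%:R - t%:R) / t.+1%:R).
Proof.
rewrite sumrB -mulr_sumr sumrB -mulr_suml sumrB !sumr_const card_ord.
rewrite -natr_sum sum_card_stars ratio -(mulr_natr t%:R) -(mulr_natr t.+1%:R^-1) natrM.
have t_neq0 : (t.+1%:R : rat) != 0 by rewrite pnatr_eq0.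
move: t_neq0; rewrite -!(natr1 t) -!(natr1 K) => t_neq0.
by field.
Qed.

Lemma sum_tangent_leif :
  F%:R * ((K%:R - t%:R) / t.+1%:R)
    <= \sum_i (K%:R - #|stars i|%:R) / #|stars i|.+1%:R
    ?= iff [forall i, #|stars i| == t] :> rat.
Proof.
rewrite -sum_tangent.
exact: (leif_sum (fun i _ => tangent_leif K #|stars i| t)).
Qed.

Lemma sum_weight_leif :
  \sum_i (K%:R - #|stars i|%:R) / #|stars i|.+1%:R <= S%:R
    ?= iff [forall s, \sum_(ij in occurrences s)
                        (#|stars ij.1|.+1%:R)^-1 == 1 :> rat]
    :> rat.
Proof.
rewrite -sum_occurrences_weight.
have <- : \sum_(s < S) 1 = S%:R :> rat by rewrite sumr_const card_ord.
exact: (leif_sum (fun s _ => leif_eq (occurrences_weight_le1 s))).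
Qed.

Lemma integers_ge : F%:R * ((K%:R - t%:R) / t.+1%:R) <= S%:R :> rat.
Proof. exact: le_trans (leif_le sum_tangent_leif) (leif_le sum_weight_leif). Qed.

Lemma packets_ge : (0 < F)%N ->
  F%:R * ((K%:R - t%:R) / t.+1%:R) = S%:R :> rat -> ('C(K, t) <= F)%N.
Proof.
move=> F_gt0 /eqP; rewrite (eq_leif (leif_trans sum_tangent_leif sum_weight_leif)).
case/andP=> /forallP card_stars /forallP weight1.
have {}card_stars i : #|stars i| = t by apply/eqP.
(* Every occurrence now weighs 1 / (t + 1), and the weights of [s] add up to 1. *)
have card_occ s : #|occurrences s| = t.+1.
  have := weight1 s; under eq_bigr => ij _ do rewrite card_stars.
  rewrite sumr_const -(mulr_natr t.+1%:R^-1) => /eqP eq1; apply/eqP; rewrite -(eqr_nat rat).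
  have t_neq0 : (t.+1%:R : rat) != 0 by rewrite pnatr_eq0.
  by rewrite -[eqbLHS](mulVKf t_neq0) eq1 mulr1.
have columns s i j : (i, j) \in occurrences s ->
    snd @: occurrences s = j |: stars i.
  move=> ij_s; apply/eqP; rewrite eqEcard occurrences_columns //=.
  rewrite (card_stars1 ij_s) card_stars.
  by rewrite (card_in_imset (@snd_occurrences_inj s)) card_occ.
have exchange i j a : j \notin stars i -> a \in stars i ->
    exists i', stars i' = (j |: stars i) :\ a.
  rewrite inE => PijN a_i; case Pij: (P i j) PijN => [s|//] _.
  have ij_s : (i, j) \in occurrences s by rewrite inE Pij.
  have : a \in snd @: occurrences s by rewrite (columns s i j ij_s) setU1r.
  (* The row [i'] where [s] meets column [a] is the witness: computing the columns of [s] from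
     either row gives [j |: stars i = a |: stars i'], and [a] is not in [stars i']. *)
  case/imsetP=> -[i' a'] ia_s /= eq_a; rewrite -eq_a in ia_s.
  exists i'; rewrite -(columns s i j ij_s) (columns s i' a ia_s) setU1K //.
  by move: ia_s; rewrite !inE /= => /eqP ->.
(* It remains to see that each [t]-subset of the columns is a value of [stars], which has at most
   [F] values. *)
rewrite -{1}(card_ord K) -card_draws -[leqRHS](card_ord F).
rewrite -(size_codom stars); apply: leq_trans (card_size _).
apply/subset_leq_card/subsetP=> B; rewrite inE => /eqP card_B.
have [i <-] :=
  exchange_closed_draws (Ordinal F_gt0) card_stars exchange card_B.
exact: codom_f.
Qed.

End Bound.

End StarCounting.

Theorem mainTheorem3 (K t : nat) (t_gt0 : (0 < t)%N) (t_lt_K : (t < K)%N)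
    (P : pda K 'C(K, t) 'C(K.-1, t.-1) 'C(K, t.+1))
    (P_regular : regular t.+1 P) :
  pareto_optimal P.
Proof.
move=> F' Z' S' P'; rewrite /memory_ratio /rate /packet_number => eq_ratio.
have C_neq0 : ('C(K, t)%:R : rat) != 0.
  by rewrite pnatr_eq0 -lt0n bin_gt0 ltnW.
have F'_gt0 : (0 < F')%N by have /andP[] := pda_Z_bounds P'; apply: leq_trans.
have F'_neq0 : (F'%:R : rat) != 0 by rewrite pnatr_eq0 -lt0n.
have ratio : (K * Z' = t * F')%N.
  have CK : (K * 'C(K.-1, t.-1) = t * 'C(K, t))%N.
    by rewrite mul_bin_diag prednK.
  have /eqP := eq_ratio; rewrite eqr_div // -!natrM eqr_nat => /eqP eqZ.
  have C_gt0 : (0 < 'C(K, t))%N by rewrite bin_gt0 ltnW.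
  by apply/eqP; rewrite -(eqn_pmul2r C_gt0) -mulnA eqZ mulnA CK mulnAC.
have -> : 'C(K, t.+1)%:R / 'C(K, t)%:R = (K%:R - t%:R) / t.+1%:R :> rat.
  apply/eqP; rewrite eqr_div ?C_neq0 ?pnatr_eq0 // -natrB ?(ltnW t_lt_K) //.
  by rewrite -!natrM eqr_nat mulnC mul_bin_left.
have rate_ge := integers_ge P' ratio.
rewrite mulrC -ler_pdivlMr ?ltr0n // in rate_ge.
(* Condition (ii) is vacuous, since no rate lies below the MN rate. For (i), an equal rate would
   force [F'] to be at least ['C(K, t)]. *)
split=> [lt_F|]; last by rewrite ltNge rate_ge.
rewrite lt_neqAle rate_ge andbT; apply/eqP=> eq_rate.
have : ('C(K, t) <= F')%N.
  by apply: (packets_ge P' ratio F'_gt0); rewrite eq_rate mulrC divfK.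
by rewrite leqNgt lt_F.
Qed.
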